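(* Suppose the piecewise-affine map $f_\mu$ on $\mathbb R^N$ ($N\ge 2$) is at a (terminating or non-terminating) shrinking point with associated rotational symbol sequence $\mathcal S=\mathcal S[l,m,n]$. Let $\check{\mathcal S}=\mathcal S^{\overline 0}$, let $p=p_0=\mu(I-M_{\check{\mathcal S}})^{-1}P_{\check{\mathcal S}}b$, let $p_i$ be the $i$-th iterate of $p$ via $\check{\mathcal S}$, and let $t_i$ be the first component of $p_i$ (with $t=t_0$). Then: a) $t=t_{ld}=0$; b) if the shrinking point is non-terminating, then $t_d,\,t_{(l-1)d}<0$ and $t_{(l+1)d},\,t_{-d}>0$; if the shrinking point is terminating, then $t_{id}<0$ for all $i\neq 0,-1$ (modulo $n$); c) $\{p_i\}$ has period $n$; d) the iterates of $p$ are the vertices of an invariant, (in general) nonplanar $n$-gon $\mathcal P$ that is comprised of uncountably many $\mathcal S$-cycles, and the restriction of $f_\mu$ to $\mathcal P$ is homeomorphic (i.e. topologically conjugate) to rigid rotation of the circle with rotation number $m/n$.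
   Context: **The map.** For $x\in\mathbb R^N$ write $s=e_1^{\mathsf T}x$ for the first component. The map is $f_\mu(x)=f_\mu^{\mathsf L}(x)$ for $s\le 0$ and $f_\mu(x)=f_\mu^{\mathsf R}(x)$ for $s\ge 0$, where $f_\mu^{i}(x)=\mu b+A_ix$ ($i=\mathsf L,\mathsf R$), $\mu\in\mathbb R$, $b\in\mathbb R^N$, and $A_{\mathsf L},A_{\mathsf R}$ are real $N\times N$ matrices that are identical in all but possibly their first columns (so $f_\mu$ is continuous). The switching manifold is $\{s=0\}$. Let $\varrho^{\mathsf T}=e_1^{\mathsf T}\mathrm{adj}(I-A_{\mathsf L})=e_1^{\mathsf T}\mathrm{adj}(I-A_{\mathsf R})$, where adj is the adjugate. **Symbol sequences.** A symbol sequence of length $n$ is $\mathcal S\in\{\mathsf L,\mathsf R\}^n$, indexed $0,\dots,n-1$; indices are taken modulo $n$. $\mathcal S^{(i)}$ is the $i$-th left cyclic permutation, $(\mathcal S^{(i)})_j=\mathcal S_{i+j}$. $\mathcal S^{\overline{i}}$ is $\mathcal S$ with its $i$-th element flipped ($\mathsf L\leftrightarrow\mathsf R$). For $l,m,n\in\mathbb N$ with $l,m<n$, $\gcd(m,n)=1$, and $d$ the inverse of $m$ modulo $n$, the rotational symbol sequence $\mathcal S[l,m,n]$ is defined by $\mathcal S_{id}=\mathsf L$ for $i=0,\dots,l-1$ and $\mathcal S_{id}=\mathsf R$ for $i=l,\dots,n-1$. **Cycles.** Given $x=x_0$ and $\mathcal S$, the iterates of $x$ via $\mathcal S$ are $x_{i+1}=f_\mu^{\mathcal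 S_i}(x_i)$, with $s_i=e_1^{\mathsf T}x_i$. Put $M_{\mathcal S}=A_{\mathcal S_{n-1}}\cdots A_{\mathcal S_0}$ and $P_{\mathcal S}=I+A_{\mathcal S_{n-1}}+A_{\mathcal S_{n-1}}A_{\mathcal S_{n-2}}+\cdots+A_{\mathcal S_{n-1}}\cdots A_{\mathcal S_1}$. If $(I-M_{\mathcal S})x_0=\mu P_{\mathcal S}b$ (equivalently $x_n=x_0$), then $\{x_0,\dots,x_{n-1}\}$ is an $\mathcal S$-cycle. It is admissible if for every $i$: $\mathcal S_i=\mathsf L$ whenever $s_i<0$ and $\mathcal S_i=\mathsf R$ whenever $s_i>0$ (no restriction if $s_i=0$). **Non-terminating shrinking point.** $f_\mu$ ($N\ge2$, $\mu\ne0$, $\varrho^{\mathsf T}b\ne0$) is at a non-terminating shrinking point, with $\mathcal S=\mathcal S[l,m,n]$, $1<l<n-1$, if: $P_{\mathcal S}$ and $P_{\mathcal S^{((l-1)d)}}$ are singular; $I-M_{\check{\mathcal S}}$ and $I-M_{\hat{\mathcal S}}$ are nonsingular, where $\check{\mathcal S}=\mathcal S^{\overline 0}$, $\hat{\mathcal S}=\mathcal S^{\overline{ld}}$; and the orbit $\{p_i\}$ of $p=p_0=\mu(I-M_{\check{\mathcal S}})^{-1}P_{\check{\mathcal S}}b$ iterated via $\check{\mathcal S}$ is admissible. **Terminating shrinking point.** $f_\mu$ ($N\ge2$) is at a terminating shrinking point, with $\mathcal S=\mathcal S[l,m,n]$, $l=n-1$, $n\ge3$, if: $I-A_{\mathsf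 L}$ is nonsingular and $\mu\varrho^{\mathsf T}b/\det(I-A_{\mathsf L})<0$; $I-M_{\check{\mathcal S}}$ is nonsingular, where $\check{\mathcal S}=\mathcal S^{\overline0}$; and $e^{\pm 2\pi \mathrm i m/n}$ are multipliers (eigenvalues) of $A_{\mathsf L}$. **Polygon.** An $n$-gon in $\mathbb R^N$ is a closed polygonal curve with $n$ distinct vertices and no self-intersections; ''nonplanar'' means it is not required to lie in a plane. *)

(* Defs.v *)
From HB Require Import structures.
From mathcomp Require Import all_boot all_order all_algebra.
From mathcomp Require Import complex.
From mathcomp Require Import all_classical all_reals all_analysis.

Set Implicit Arguments.
Unset Strict Implicit.
Unset Printing Implicit Defensive.

Import Order.TTheory GRing.Theory Num.Theory.
Import numFieldNormedType.Exports.

Local Open Scope classical_set_scope.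
Local Open Scope ring_scope.

Inductive symbol := symL | symR.

Definition opp_symbol (a : symbol) : symbol :=
  match a with symL => symR | symR => symL end.

(* Indices of a symbol sequence of length n are taken modulo n; ['Z_n] is
   Z/nZ only for n >= 2, which holds at every shrinking point (n >= 3). *)
Definition symseq (n : nat) := 'Z_n -> symbol.

Definition shiftseq (n : nat) (S : symseq n) (i : 'Z_n) : symseq n :=
  fun j => S (i + j).

Definition flipseq (n : nat) (S : symseq n) (i : 'Z_n) : symseq n :=
  fun j => if j == i then opp_symbol (S j) else S j.

Definition invmod (m n : nat) : 'Z_n := (m%:R)^-1.

Definition rotseq (l m n : nat) : symseq n := fun j =>
  if [exists i : 'I_l, j == i%:R * invmod m n] then symL else symR.

Lemma rotseqE (l m n i : nat) : (1 < n)%N -> coprime m n -> (l <= n)%N ->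
  (i < n)%N ->
  @rotseq l m n (i%:R * invmod m n) = if (i < l)%N then symL else symR.
Proof.
move=> n1 cmn ln iltn; rewrite /rotseq /invmod.
have Um : (m%:R : 'Z_n) \is a GRing.unit by rewrite unitZpE // coprime_sym.
congr (if _ then _ else _); apply/existsP/idP => [[k /eqP]|il]; last first.
  by exists (Ordinal il).
move=> /(congr1 (fun z => z * m%:R)); rewrite !mulrVK //.
move=> /(congr1 val); rewrite /= !val_Zp_nat // !modn_small //.
  by move=> ->.
exact: leq_trans (ltn_ord k) ln.
Qed.

(* Dimension is N.+1, so that the first coordinate [ord0] always exists. *)
Record pwAffine (R : realType) (N : nat) := PwAffine {
  pmu : R;
  pb : 'cV[R]_N.+1;
  matL : 'M[R]_N.+1;
  matR : 'M[R]_N.+1;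
  matLR : forall i j : 'I_N.+1, j != ord0 -> matL i j = matR i j }.

Definition fstc (R : realType) (N : nat) (x : 'cV[R]_N.+1) : R := x ord0 ord0.

Definition matS (R : realType) (N : nat) (F : pwAffine R N) (a : symbol) :
    'M[R]_N.+1 :=
  match a with symL => matL F | symR => matR F end.

Definition fhalf (R : realType) (N : nat) (F : pwAffine R N) (a : symbol)
    (x : 'cV[R]_N.+1) : 'cV[R]_N.+1 :=
  pmu F *: pb F + matS F a *m x.

(* The two half-maps coincide where [fstc x = 0]. *)
Definition pwmap (R : realType) (N : nat) (F : pwAffine R N)
    (x : 'cV[R]_N.+1) : 'cV[R]_N.+1 :=
  if fstc x <= 0 then fhalf F symL x else fhalf F symR x.

Definition rhoT (R : realType) (N : nat) (F : pwAffine R N) : 'rV[R]_N.+1 :=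
  row ord0 (\adj (1%:M - matL F)).

Definition rhoTb (R : realType) (N : nat) (F : pwAffine R N) : R :=
  (rhoT F *m pb F) ord0 ord0.

Fixpoint orbS (R : realType) (N : nat) (F : pwAffine R N) (n : nat)
    (S : symseq n) (x : 'cV[R]_N.+1) (k : nat) : 'cV[R]_N.+1 :=
  if k is k'.+1 then fhalf F (S k'%:R) (orbS F S x k') else x.

(* A_{S_{n-1}} ... A_{S_{n-j}} *)
Definition tailM (R : realType) (N : nat) (F : pwAffine R N) (n : nat)
    (S : symseq n) (j : nat) : 'M[R]_N.+1 :=
  \prod_(0 <= i < j) matS F (S (n - i.+1)%:R).

Definition MS (R : realType) (N : nat) (F : pwAffine R N) (n : nat)
    (S : symseq n) : 'M[R]_N.+1 := tailM F S n.

Definition PS (R : realType) (N : nat) (F : pwAffine R N) (n : nat)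
    (S : symseq n) : 'M[R]_N.+1 := \sum_(0 <= j < n) tailM F S j.

Definition is_Scycle (R : realType) (N : nat) (F : pwAffine R N) (n : nat)
    (S : symseq n) (C : set 'cV[R]_N.+1) : Prop :=
  exists x : 'cV[R]_N.+1,
    (1%:M - MS F S) *m x = pmu F *: (PS F S *m pb F) /\
    C = [set orbS F S x k | k in `I_n].

Definition admissible (R : realType) (N : nat) (F : pwAffine R N) (n : nat)
    (S : symseq n) (x : 'cV[R]_N.+1) : Prop :=
  forall k : nat, (k < n)%N ->
    (fstc (orbS F S x k) < 0 -> S k%:R = symL) /\
    (0 < fstc (orbS F S x k) -> S k%:R = symR).

Definition checkS (l m n : nat) : symseq n := flipseq (@rotseq l m n) 0.

Definition hatS (l m n : nat) : symseq n :=
  flipseq (@rotseq l m n) (l%:R * invmod m n).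

Definition shrink_pt (R : realType) (N : nat) (F : pwAffine R N)
    (l m n : nat) : 'cV[R]_N.+1 :=
  pmu F *: (invmx (1%:M - MS F (@checkS l m n)) *m
            (PS F (@checkS l m n) *m pb F)).

Definition nonterminating_shrinking_point (R : realType) (N : nat)
    (F : pwAffine R N) (l m n : nat) : Prop :=
  let S := @rotseq l m n in
  [/\ (1 < l < n.-1)%N, pmu F != 0 & rhoTb F != 0] /\
  [/\ PS F S \notin unitmx,
      PS F (shiftseq S (l.-1%:R * invmod m n)) \notin unitmx,
      1%:M - MS F (@checkS l m n) \in unitmx,
      1%:M - MS F (@hatS l m n) \in unitmx &
      admissible F (@checkS l m n) (shrink_pt F l m n)].

Definition expi (R : realType) (t : R) : R[i] := (cos t +i* sin t)%C.

Definition is_multiplier (R : realType) (N : nat) (A : 'M[R]_N.+1)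
    (z : R[i]) : Prop :=
  eigenvalue (map_mx (real_complex R) A) z.

Definition terminating_shrinking_point (R : realType) (N : nat)
    (F : pwAffine R N) (l m n : nat) : Prop :=
  let theta : R := 2 * pi * m%:R / n%:R in
  (l = n.-1 /\ (3 <= n)%N) /\
  [/\ 1%:M - matL F \in unitmx,
      pmu F * rhoTb F / \det (1%:M - matL F) < 0,
      1%:M - MS F (@checkS l m n) \in unitmx,
      is_multiplier (matL F) (expi theta) &
      is_multiplier (matL F) (expi (- theta))].

Definition least_period (T : Type) (u : nat -> T) (n : nat) : Prop :=
  [/\ (0 < n)%N, forall i, u (i + n)%N = u i &
      forall k, (0 < k < n)%N -> ~ (forall i, u (i + k)%N = u i)].

Definition segm (R : realType) (N : nat) (x y : 'cV[R]_N.+1) :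
    set 'cV[R]_N.+1 :=
  [set (1 - r) *: x + r *: y | r in `[0, 1]].

Definition edge (R : realType) (N n : nat) (v : 'Z_n -> 'cV[R]_N.+1)
    (i : 'Z_n) : set 'cV[R]_N.+1 :=
  segm (v i) (v (i + 1)).

Definition polygon (R : realType) (N n : nat) (v : 'Z_n -> 'cV[R]_N.+1) :
    set 'cV[R]_N.+1 :=
  \bigcup_(i in [set: 'Z_n]) edge v i.

(* Two distinct edges meet exactly in their common endpoints. *)
Definition simple_ngon (R : realType) (N n : nat)
    (v : 'Z_n -> 'cV[R]_N.+1) : Prop :=
  [/\ (3 <= n)%N, injective v &
      forall i j : 'Z_n, i != j ->
        edge v i `&` edge v j =
        [set v i; v (i + 1)] `&` [set v j; v (j + 1)]].

Definition unit_circle (R : realType) : set (R * R) :=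
  [set z | z.1 ^+ 2 + z.2 ^+ 2 = 1].

Definition rotation (R : realType) (t : R) (z : R * R) : R * R :=
  (cos t * z.1 - sin t * z.2, sin t * z.1 + cos t * z.2).

Definition homeo_between (T U : topologicalType) (A : set T) (B : set U)
    (h : T -> U) : Prop :=
  exists g : U -> T,
    [/\ set_fun A B h, set_fun B A g,
        {in A, cancel h g} & {in B, cancel g h}] /\
    ({within A, continuous h} /\ {within B, continuous g}).

Definition conj_rigid_rotation (R : realType) (T : topologicalType)
    (f : T -> T) (A : set T) (rho : R) : Prop :=
  exists h : T -> R * R,
    homeo_between A (@unit_circle R) h /\
    forall x, A x -> h (f x) = rotation (2 * pi * rho) (h x).

(* Main.v *)
Require Import Defs.
From HB Require Import structures.
From mathcomp Require Import all_boot all_order all_algebra.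
From mathcomp Require Import complex.
From mathcomp Require Import all_classical all_reals all_analysis.
From mathcomp Require Import ring lra zify.

(** Number the cycle {p_i} in its spatial order, v_k = p_{kd}: the map then
    sends v_k to v_{k+m}, and a symbol sequence S[l,m,n] reads L on
    k = 0, ..., l-1 and R on k = l, ..., n-1.

    If P_S is singular with left null vector w, then w^T(I - M) is a multiple of
    e_1^T, because I - M = P_S (I - A_L) off the first column; applied to the
    cycle equation (I - M) p = mu P_S b it gives t = 0, and the same argument
    started at p_{ld} gives t_{ld} = 0.  A point with vanishing first component
    may carry either symbol.  Hence a further zero next to k = 0 or k = l would
    make {p_i} a cycle of a shift of its own sequence; by uniqueness of cycles it
    would be a fixed point on the switching manifold, contrary to
    rho^T b <> 0.  At a terminating shrinking point the cycle is a regular n-gon,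
    up to an affine map, in the eigenplane of e^{+-2 pi i m/n} through the fixed
    point of f^L, scaled so that one edge lies in the switching manifold.

    Each edge of the polygon lies in one closed half-space, so f maps edge k
    affinely onto edge k + m.  Two coinciding edge points therefore have
    the same sequence of first components, and its sign pattern determines the
    edge and the position on it: this makes the polygon simple, splits it into
    one S-cycle for each position r in [0, 1), and conjugates f to the rotation
    of the circle when the point at position r of edge k is sent to the angle
    2 pi (k + r)/n. *)

Set Implicit Arguments.
Unset Strict Implicit.
Unset Printing Implicit Defensive.

Import Order.TTheory GRing.Theory Num.Theory.
Import numFieldNormedType.Exports.

Local Open Scope classical_set_scope.
Local Open Scope ring_scope.

Lemma notin_unitmxP (K : fieldType) k (A : 'M[K]_k) : A \notin unitmx ->
  exists2 w : 'rV[K]_k, w != 0 & w *m A = 0.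
Proof.
rewrite -row_free_unit -kermx_eq0 => /rowV0Pn[w /sub_kermxP wA w0].
by exists w.
Qed.

(** * Cycles of symbol sequences *)

Section Cycles.
Variables (R : realType) (N : nat) (F : pwAffine R N).
Implicit Types (a : symbol) (x : 'cV[R]_N.+1).

Lemma matS_col_eq a a' x : fstc x = 0 -> matS F a *m x = matS F a' *m x.
Proof.
move=> x0; suff E : matL F *m x = matR F *m x by case: a; case: a'.
apply/matrixP => i j; rewrite !mxE; apply: eq_bigr => k _.
case: (eqVneq k ord0) => [->|kN0]; last by rewrite (matLR F i kN0).
by rewrite (ord1 j); move: x0; rewrite /fstc => ->; rewrite !mulr0.
Qed.

Lemma fhalf_eq a a' x : fstc x = 0 -> fhalf F a x = fhalf F a' x.
Proof. by move=> x0; rewrite /fhalf (matS_col_eq a a' x0). Qed.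

Lemma fhalf_convex a x y (r : R) :
  fhalf F a ((1 - r) *: x + r *: y) = (1 - r) *: fhalf F a x + r *: fhalf F a y.
Proof.
rewrite /fhalf mulmxDr -!scalemxAr !scalerDr addrACA; congr (_ + _).
by rewrite -scalerDl subrK scale1r.
Qed.

Lemma fstc_convex x y (r : R) :
  fstc ((1 - r) *: x + r *: y) = (1 - r) * fstc x + r * fstc y.
Proof. by rewrite /fstc !mxE. Qed.

Variable n' : nat.
Local Notation n := n'.+2.
Implicit Types (T : symseq n) (q : 'Z_n -> 'cV[R]_N.+1) (i : 'Z_n).

(** Indexing by Z/n builds the closing condition into the recurrence, and a shift of the symbols
    becomes a translation of the index. *)
Definition is_cycle T q := forall i, q (i + 1) = fhalf F (T i) (q i).

(** The half-maps agree on the switching manifold, so the symbol of a point there is free. Later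
    changes of symbols rest on this. *)
Lemma is_cycle_relabel T T' q :
  is_cycle T q -> (forall i, fstc (q i) != 0 -> T' i = T i) -> is_cycle T' q.
Proof.
move=> cq TT' i; rewrite cq; case: (eqVneq (fstc (q i)) 0) => [q0|/TT' -> //].
exact: fhalf_eq.
Qed.

Lemma is_cycle_shift T q j :
  is_cycle T q -> is_cycle (shiftseq T j) (fun i => q (j + i)).
Proof. by move=> cq i; rewrite addrA cq. Qed.

Lemma orbS_is_cycle T q k : is_cycle T q -> orbS F T (q 0) k = q k%:R.
Proof. by move=> cq; elim: k => //= k ->; rewrite -natr1 cq. Qed.

(** [tailM] multiplies from the last factor downwards, so the induction peels steps off the end of
    the orbit; j = n gives the formula with [MS] and [PS]. *)
Lemma orbS_tailM T x j : (j <= n)%N ->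
  orbS F T x n = tailM F T j *m orbS F T x (n - j)
    + pmu F *: ((\sum_(0 <= i < j) tailM F T i) *m pb F).
Proof.
elim: j => [|j IH] jn.
  by rewrite subn0 /tailM !big_nil mul1mx mul0mx scaler0 addr0.
rewrite (IH (ltnW jn)) (big_nat_recr j) //= -(subnSK jn).
rewrite [orbS F T x (_.+1)]/= /fhalf mulmxDr mulmxA.
have -> : tailM F T j.+1 = tailM F T j *m matS F (T (n - j.+1)%:R).
  by rewrite /tailM big_nat_recr.
rewrite mulmxDl scalerDr -scalemxAr -!addrA addrC -!addrA; congr (_ + _).
Qed.

Lemma orbS_closed T x :
  orbS F T x n = MS F T *m x + pmu F *: (PS F T *m pb F).
Proof. by rewrite (orbS_tailM T x (leqnn n)) subnn. Qed.

Lemma Zn_valS i : (val i < n'.+1)%N -> val (i + 1) = (val i).+1.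
Proof. by move=> il; rewrite /= addn1 modn_small // ltnS. Qed.

Lemma Zn_val_last i : (n'.+1 <= val i)%N -> i + 1 = 0.
Proof.
move=> il; apply: val_inj => /=.
have -> : val i = n'.+1 by apply/eqP; rewrite eqn_leq il -ltnS ltn_ord.
by rewrite addn1 modnn.
Qed.

Lemma orbS_cycle T x :
  (1%:M - MS F T) *m x = pmu F *: (PS F T *m pb F) ->
  is_cycle T (fun i => orbS F T x (val i)).
Proof.
move=> E i; have Ex : orbS F T x n = x.
  by rewrite orbS_closed -E mulmxBl mul1mx addrC subrK.
case: (ltnP (val i) n'.+1) => il.
  by rewrite Zn_valS //= natr_Zp.
rewrite Zn_val_last //.
have iE : val i = n'.+1 by apply/eqP; rewrite eqn_leq il -ltnS ltn_ord.
have -> : fhalf F (T i) (orbS F T x (val i)) = orbS F T x (val i).+1.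
  by rewrite [RHS]/= natr_Zp.
by rewrite iE Ex.
Qed.

Lemma is_cycle_eq T q : is_cycle T q ->
  (1%:M - MS F T) *m q 0 = pmu F *: (PS F T *m pb F).
Proof.
move=> cq; have := orbS_closed T (q 0); rewrite orbS_is_cycle // pchar_Zp //.
by rewrite mulmxBl mul1mx => {1}->; rewrite addrC addKr.
Qed.

(** Stands in for nonsingularity of I - M_T: it passes to cyclic shifts of T by mere reindexing,
    with no comparison of matrix products. *)
Definition unique_cycle T :=
  forall q q', is_cycle T q -> is_cycle T q' -> forall i, q i = q' i.

Lemma unique_cycle_shift T j : unique_cycle T -> unique_cycle (shiftseq T j).
Proof.
move=> uT q q' cq cq' i.
have H p : is_cycle (shiftseq T j) p -> is_cycle T (fun k => p (k - j)).
  by move=> cp k; rewrite addrAC cp /shiftseq [j + _]addrC subrK.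
by have := uT _ _ (H _ cq) (H _ cq') (i + j); rewrite addrK.
Qed.

Lemma unitmx_unique_cycle T : 1%:M - MS F T \in unitmx -> unique_cycle T.
Proof.
move=> U q q' cq cq'.
have E : q 0 = q' 0.
  by rewrite -[q 0](mulKmx U) is_cycle_eq // -(is_cycle_eq cq') mulKmx.
by move=> i; rewrite -(natr_Zp i) -(orbS_is_cycle _ cq) E orbS_is_cycle.
Qed.

(** A kernel vector of I - M_T, added to the starting point, would give a second cycle. The
    transposes turn a row kernel vector into a column one. *)
Lemma unique_cycle_unitmx T q :
  is_cycle T q -> unique_cycle T -> 1%:M - MS F T \in unitmx.
Proof.
move=> cq uT; apply/negPn/negP => nU.
have /notin_unitmxP[w w0 wA] : (1%:M - MS F T)^T \notin unitmx.
  by rewrite unitmx_tr.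
have Aw : (1%:M - MS F T) *m w^T = 0.
  by apply: trmx_inj; rewrite trmx_mul trmxK wA trmx0.
have E : (1%:M - MS F T) *m (q 0 + w^T) = pmu F *: (PS F T *m pb F).
  by rewrite mulmxDr Aw addr0 is_cycle_eq.
have := uT _ _ cq (orbS_cycle E) 0 => /= /eqP.
by rewrite -subr_eq0 opprD addrA subrr add0r oppr_eq0 trmx_eq0 (negPf w0).
Qed.

(* Off the first column, [1 - MS F T] is [PS F T *m (1 - matL F)]. *)
Lemma mul_one_sub_MS T (w : 'rV[R]_N.+1) (j : 'I_N.+1) :
  w *m PS F T = 0 -> j != ord0 -> (w *m (1%:M - MS F T)) ord0 j = 0.
Proof.
move=> wP j0.
have -> : 1%:M - MS F T = PS F T *m (1%:M - matL F)
    + \sum_(0 <= k < n) tailM F T k *m (matL F - matS F (T (n - k.+1)%:R)).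
  rewrite /PS mulmx_suml -big_split /=.
  under eq_bigr => k _ do rewrite -mulmxDr addrA subrK mulmxBr mulmx1.
  (* Absorbing a factor into [tailM] makes the sum telescope to I - M_T. *)
  have E k : tailM F T k *m matS F (T (n - k.+1)%:R) = tailM F T k.+1.
    by rewrite /tailM big_nat_recr.
  under eq_bigr => k _ do rewrite E -[_ - _]opprB.
  by rewrite sumrN telescope_sumr // opprB /MS /tailM big_nil.
rewrite mulmxDr mulmxA wP mul0mx add0r mulmx_sumr summxE big1 // => k _.
rewrite mulmxA mxE big1 // => i _; rewrite !mxE.
by case: (T _); rewrite /= ?(matLR F i j0) subrr mulr0.
Qed.

Lemma PS_singular_fstc0 T q : is_cycle T q -> unique_cycle T ->
  PS F T \notin unitmx -> fstc (q 0) = 0.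
Proof.
move=> cq uT /notin_unitmxP[w w0 wP].
have U := unique_cycle_unitmx cq uT.
pose c := (w *m (1%:M - MS F T)) ord0 ord0.
have wE : w *m (1%:M - MS F T) = c *: delta_mx ord0 ord0.
  apply/rowP => j; rewrite [RHS]mxE [delta_mx _ _ _ _]mxE eqxx /=.
  case: eqVneq => [->|j0]; first by rewrite mulr1.
  by rewrite mulr0; exact: mul_one_sub_MS.
have c0 : c != 0.
  apply: contra_neq w0 => c0.
  by rewrite -[w](mulmxK U) wE c0 scale0r mul0mx.
have : w *m (1%:M - MS F T) *m q 0 = 0.
  by rewrite -mulmxA is_cycle_eq // -scalemxAr mulmxA wP mul0mx scaler0.
rewrite wE -scalemxAl => /matrixP/(_ ord0 ord0).
rewrite !mxE big_ord_recl !mxE eqxx mul1r big1 => [|j _]; last first.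
  by rewrite mxE /= mul0r.
by rewrite addr0 => /eqP; rewrite mulf_eq0 (negPf c0) => /eqP.
Qed.

(** The products in P_T run over the indices n-1 down to 1 only, so the symbol at 0 never enters;
    P_S is therefore also the matrix P of [checkS]. *)
Lemma PS_flip0 T : PS F (flipseq T 0) = PS F T.
Proof.
rewrite /PS; apply: eq_big_nat => j /andP[_ jn].
rewrite /tailM; apply: eq_big_nat => i /andP[_ ij].
rewrite /flipseq ifN //; apply/eqP => /(congr1 val).
rewrite /= val_Zp_nat // modn_small; last by rewrite ltnS leq_subLR; lia.
by move/eqP; rewrite subn_eq0 leqNgt (leq_ltn_trans ij jn).
Qed.

End Cycles.

(** * Parametrised closed curves *)

Section GluedHomeo.
Variables (R : realType) (X Y : topologicalType) (I : finType).

(** The preimage of a closed C is a finite union, over the arcs, of images of the parameter sets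
    where b_i lies in C. These sets are compact, so their images are closed in a Hausdorff space. *)
Lemma glued_continuous (a : I -> R -> X) (b : I -> R -> Y) (h : X -> Y) :
  hausdorff_space X -> (forall i, continuous (a i)) ->
  (forall i, continuous (b i)) ->
  (forall i r, r \in `[0, 1] -> h (a i r) = b i r) ->
  {within \bigcup_(i in [set: I]) (a i @` `[0, 1]), continuous h}.
Proof.
move=> hX ca cb hab; apply/continuous_closedP => C cC; apply/closed_subspaceP.
exists (\bigcup_(i in [set: I]) (a i @` (`[0, 1] `&` b i @^-1` C))).
  apply: closed_bigcup => [|i _]; first exact: finite_finset.
  apply: compact_closed => //; apply: continuous_compact.
    exact: continuous_subspaceT.
  apply: compact_closedI; first exact: segment_compact.
  by apply: preimage_closed => // x _; exact: cb.
apply/seteqP; split => x /= [].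
  move=> [i _ [r [rI bC] <-]] _; split; last by exists i => //; exists r.
  by change (C (h (a i r))); rewrite hab.
move=> hC [i _ [r rI rx]]; have {hC} bC : C (b i r) by rewrite -hab // rx.
split; last by exists i => //; exists r.
by exists i => //; exists r.
Qed.

End GluedHomeo.

Lemma glued_map (R : realType) (X Y : topologicalType) (I : finType)
    (i0 : I) (a : I -> R -> X) (b : I -> R -> Y) :
  (forall i j r s, r \in `[0, 1] -> s \in `[0, 1] ->
     a i r = a j s -> b i r = b j s) ->
  exists h : X -> Y, forall i r, r \in `[0, 1] -> h (a i r) = b i r.
Proof.
move=> ab.
(* Compatibility makes [G x] a singleton on the curve; [b i0 0] is a default value off it. *)
pose G x := [set y | exists i r, [/\ r \in `[0, 1], a i r = x & b i r = y]].
exists (fun x => xget (b i0 0) (G x)) => i r rI.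
case: xgetP => [y -> [j [s [sI sr <-]]]|/(_ (b i r)) []].
  exact: ab.
by exists i, r.
Qed.

(** The compatibility is an equivalence, hence symmetric in a and b, so the inverse is glued in the
    same way. *)
Lemma glued_homeo (R : realType) (X Y : topologicalType) (I : finType)
    (i0 : I) (a : I -> R -> X) (b : I -> R -> Y) :
  hausdorff_space X -> hausdorff_space Y ->
  (forall i, continuous (a i)) -> (forall i, continuous (b i)) ->
  (forall i j r s, r \in `[0, 1] -> s \in `[0, 1] ->
     a i r = a j s <-> b i r = b j s) ->
  exists h : X -> Y,
    homeo_between (\bigcup_(i in [set: I]) (a i @` `[0, 1]))
      (\bigcup_(i in [set: I]) (b i @` `[0, 1])) h /\
    forall i r, r \in `[0, 1] -> h (a i r) = b i r.
Proof.
move=> hX hY ca cb ab.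
have [|h hE] := @glued_map R X Y I i0 a b; first by move=> i j r s rI sI /ab->.
have [|g gE] := @glued_map R Y X I i0 b a; first by move=> i j r s rI sI /ab->.
exists h; split=> //; exists g; split; split.
- by move=> _ [i _ [r rI <-]]; exists i => //; exists r; rewrite ?hE.
- by move=> _ [i _ [r rI <-]]; exists i => //; exists r; rewrite ?gE.
- by move=> x /set_mem [i _ [r rI <-]]; rewrite hE ?gE.
- by move=> x /set_mem [i _ [r rI <-]]; rewrite gE ?hE.
- exact: (glued_continuous hX ca cb).
- exact: (glued_continuous hY cb ca).
Qed.

(** * The unit circle and its rotations *)

Section Circle.
Variable R : realType.
Implicit Types x y u v : R.

(** Half the difference, z, satisfies cos 2z = 1, so sin z = 0, and |z| < pi leaves only z = 0. *)
Lemma cos_sin_inj x y : `|x - y| < 2 * pi ->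
  cos x = cos y -> sin x = sin y -> x = y.
Proof.
move=> xy cE sE; set z := (x - y) / 2.
have sz : sin z = 0.
  have : cos (z *+ 2) = 1.
    rewrite -mulr_natr /z divfK ?pnatr_eq0 // cosB cE sE -!expr2.
    exact: cos2Dsin2.
  rewrite cos_mulr2n => H; have := cos2Dsin2 z => H2.
  by apply/eqP; rewrite -sqrf_eq0; apply/eqP; lra.
have zB : `|z| < pi.
  by rewrite /z normrM normfV (ger0_norm (ler0n R 2)) ltr_pdivrMr // mulrC.
have : z = 0.
  case: (ltrgtP z 0) => // z0.
    have : 0 < sin (- z) by apply: sin_gt0_pi; move: zB; rewrite ltr_norml; lra.
    by rewrite sinN sz oppr0 ltxx.
  have : 0 < sin z by apply: sin_gt0_pi; move: zB; rewrite ltr_norml; lra.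
  by rewrite sz ltxx.
by rewrite /z; lra.
Qed.

Lemma unit_circle_angle u v : u ^+ 2 + v ^+ 2 = 1 ->
  exists2 x, 0 <= x <= 2 * pi & u = cos x /\ v = sin x.
Proof.
move=> uv.
have uI : -1 <= u <= 1.
  by rewrite -ler_norml -(@expr_le1 _ 2%N) // real_normK ?num_real //; nra.
have sE : sin (acos u) = `|v|.
  rewrite sin_acos // -uv addrAC subrr add0r; exact: sqrtr_sqr.
have /andP[a0 aP] : 0 <= acos u <= pi by rewrite acos_ge0 // acos_lepi.
case: (lerP 0 v) => v0.
  exists (acos u); first by lra.
  by rewrite acosK ?in_itv // sE ger0_norm.
exists (2 * pi - acos u); first by lra.
have -> : 2 * pi - acos u = - acos u + pi *+ 2 by rewrite mulr_natl addrC.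
by rewrite cosD2pi sinD2pi cosN sinN acosK ?in_itv // sE ltr0_norm // opprK.
Qed.

(** Measuring angles in turns makes the period 1 and the rotation number the angle of rotation. *)
Definition circle_pt x : R * R := (cos (2 * pi * x), sin (2 * pi * x)).

Lemma circle_pt_continuous : continuous circle_pt.
Proof.
have c : continuous (fun x => 2 * pi * x) := @mulrl_continuous R _.
move=> x.
have cc : {for x, continuous (fun x => cos (2 * pi * x))}.
  by apply: continuous_comp; [exact: c|exact: continuous_cos].
have cs : {for x, continuous (fun x => sin (2 * pi * x))}.
  by apply: continuous_comp; [exact: c|exact: continuous_sin].
exact: (cvg_pair cc cs).
Qed.

Lemma circle_pt_periodic (k : nat) x : circle_pt (x + k%:R) = circle_pt x.
Proof.
elim: k => [|k IH]; first by rewrite addr0.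
rewrite -IH -natr1 addrA /circle_pt [2 * pi * (_ + 1)]mulrDr mulr1.
by rewrite mulr_natl cosD2pi sinD2pi.
Qed.

Lemma circle_pt_rotation x t :
  circle_pt (x + t) = rotation (2 * pi * t) (circle_pt x).
Proof.
rewrite /circle_pt /rotation /= mulrDr cosD sinD.
by congr (_, _); ring.
Qed.

Lemma circle_pt_inj x y : `|x - y| < 1 -> circle_pt x = circle_pt y -> x = y.
Proof.
move=> xy [cE sE]; have pi0 := pi_gt0 R.
have : 2 * pi * x = 2 * pi * y.
  apply: cos_sin_inj => //; rewrite -mulrBr normrM gtr0_norm; last by nra.
  by rewrite gtr_pMr //; nra.
by apply: mulfI; rewrite mulf_neq0 ?gt_eqF.
Qed.

Lemma circle_pt_unit x : @unit_circle R (circle_pt x).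
Proof. exact: cos2Dsin2. Qed.

Lemma circle_pt_surj z : @unit_circle R z ->
  exists2 x, 0 <= x <= 1 & z = circle_pt x.
Proof.
case: z => u v uv.
have [x /andP[x0 x1] [-> ->]] := @unit_circle_angle u v uv.
have pi0 : 0 < 2 * pi :> R by rewrite mulr_gt0 ?pi_gt0.
exists (x / (2 * pi)).
  by rewrite (divr_ge0 x0 (ltW pi0)) ler_pdivrMr ?mul1r.
by rewrite /circle_pt mulrC divfK // gt_eqF.
Qed.

End Circle.

(** * The dynamics on the polygon *)

Section Polygon.
Variables (R : realType) (N : nat) (F : pwAffine R N) (n' l m : nat).
Local Notation n := n'.+2.
Variable v : 'Z_n -> 'cV[R]_N.+1.
Implicit Types (i j k c : 'Z_n) (r s : R).

Definition edge_pt k r := (1 - r) *: v k + r *: v (k + 1).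

Lemma edge_pt0 k : edge_pt k 0 = v k.
Proof. by rewrite /edge_pt subr0 scale1r scale0r addr0. Qed.

Lemma edge_pt1 k : edge_pt k 1 = edge_pt (k + 1) 0.
Proof. by rewrite edge_pt0 /edge_pt subrr scale0r scale1r add0r. Qed.

Lemma pwmapL (x : 'cV[R]_N.+1) : fstc x <= 0 -> pwmap F x = fhalf F symL x.
Proof. by rewrite /pwmap => ->. Qed.

Lemma pwmapR (x : 'cV[R]_N.+1) : 0 <= fstc x -> pwmap F x = fhalf F symR x.
Proof.
rewrite /pwmap; case: (lerP (fstc x) 0) => // x0 x1; apply: fhalf_eq.
by apply/eqP; rewrite eq_le x0.
Qed.

Hypothesis n3 : (0 < n')%N.
Hypothesis mn : coprime m n.
Hypothesis ln : (l < n)%N.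
Hypothesis edge_left : forall k, (val k < l)%N ->
  fstc (v k) <= 0 /\ fstc (v (k + 1)) <= 0.
Hypothesis edge_right : forall k, (l <= val k)%N ->
  0 <= fstc (v k) /\ 0 <= fstc (v (k + 1)).
Hypothesis v_step : forall k, v (k + m%:R) = pwmap F (v k).

Let d : 'Z_n := invmod m n.

Lemma invmodK : m%:R * d = 1.
Proof. by rewrite divrr // unitZpE // coprime_sym. Qed.

Lemma rotseq_ind k :
  @rotseq l m n (k * d) = if (val k < l)%N then symL else symR.
Proof. by rewrite -[in LHS](natr_Zp k) rotseqE // ltnW. Qed.

Lemma fstc_edge_ptL k r : 0 <= r <= 1 -> (val k < l)%N ->
  fstc (edge_pt k r) <= 0.
Proof.
move=> /andP[r0 r1] /edge_left[a b]; rewrite fstc_convex.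
by rewrite -oppr_ge0; nra.
Qed.

Lemma fstc_edge_ptR k r : 0 <= r <= 1 -> (l <= val k)%N ->
  0 <= fstc (edge_pt k r).
Proof.
by move=> /andP[r0 r1] /edge_right[a b]; rewrite fstc_convex; nra.
Qed.

(** The half-map is affine along the line through the edge and agrees with f at both ends, which lie
    in its closed half-space. *)
Lemma fhalf_edge_pt k r :
  fhalf F (@rotseq l m n (k * d)) (edge_pt k r) = edge_pt (k + m%:R) r.
Proof.
rewrite fhalf_convex rotseq_ind /edge_pt addrAC !v_step.
case: ltnP => [/edge_left|/edge_right] [a b]; first by rewrite !pwmapL.
by rewrite !pwmapR.
Qed.

Lemma pwmap_edge_pt k r : 0 <= r <= 1 ->
  pwmap F (edge_pt k r) = edge_pt (k + m%:R) r.
Proof.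
move=> rI; rewrite -fhalf_edge_pt rotseq_ind.
case: ltnP => kl; first by rewrite pwmapL // fstc_edge_ptL.
by rewrite pwmapR // fstc_edge_ptR.
Qed.

(** Equal points have equal images, and f moves both edges by m; as m is invertible modulo n,
    iteration reaches every offset k. *)
Lemma edge_pt_shift i j r s : 0 <= r <= 1 -> 0 <= s <= 1 ->
  edge_pt i r = edge_pt j s -> forall k, edge_pt (i + k) r = edge_pt (j + k) s.
Proof.
move=> rI sI E k.
have H (u : nat) : edge_pt (i + m%:R *+ u) r = edge_pt (j + m%:R *+ u) s.
  elim: u => [|u IH]; first by rewrite !mulr0n !addr0.
  by rewrite !mulrSr !addrA -!pwmap_edge_pt // IH.
have := H (val (k * d)); rewrite -[m%:R *+ _]mulr_natr natr_Zp.
by rewrite mulrCA invmodK mulr1.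
Qed.

(* The points at positions r, s of two edges that are c edges apart do not have
   the same sequence of first components, except when they are equal. *)
Definition separated (t : 'Z_n -> R) := forall c r s,
  0 <= r < 1 -> 0 <= s < 1 ->
  (forall k, (1 - r) * t k + r * t (k + 1) =
     (1 - s) * t (k + c) + s * t (k + c + 1)) -> c = 0 /\ r = s.

Hypothesis v_sep : separated (fun k => fstc (v k)).

Lemma edge_pt_inj i j r s : 0 <= r < 1 -> 0 <= s < 1 ->
  edge_pt i r = edge_pt j s -> i = j /\ r = s.
Proof.
move=> rI sI E; have [|c0 ->] := @v_sep (j - i) r s rI sI; last first.
  by split=> //; apply/esym/eqP; rewrite -subr_eq0 c0.
move=> k; rewrite -!fstc_convex; congr fstc.
have := edge_pt_shift _ _ E (k - i).
rewrite /edge_pt [i + _]addrC subrK => -> //; last 2 first.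
- by case/andP: rI => -> /ltW.
- by case/andP: sI => -> /ltW.
by rewrite [j + _]addrCA.
Qed.

Lemma v_inj : injective v.
Proof.
move=> i j; rewrite -!edge_pt0.
by case/(edge_pt_inj _ _) => //; rewrite lexx ltr01.
Qed.

Lemma edgeP i x : edge v i x -> exists2 r, 0 <= r <= 1 & x = edge_pt i r.
Proof. by move=> [r rI <-]; exists r. Qed.

Lemma le1_cases r : 0 <= r <= 1 -> 0 <= r < 1 \/ r = 1.
Proof.
move=> /andP[r0]; rewrite le_eqVlt => /orP[/eqP|r1]; first by right.
by left; apply/andP.
Qed.

Lemma simple_ngon_v : simple_ngon v.
Proof.
split; [by []|exact: v_inj|move=> i j ij].
have e0 k : edge v k (v k).
  by exists 0; rewrite -/(edge_pt k 0) ?edge_pt0 //= in_itv /= lexx ler01.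
have e1 k : edge v k (v (k + 1)).
  exists 1; rewrite -/(edge_pt k 1) ?edge_pt1 ?edge_pt0 //=.
  by rewrite in_itv /= lexx ler01.
apply/seteqP; split => x /=; last first.
  move=> [xi xj]; split; first by case: xi => ->.
  by case: xj => ->.
have I0 : 0 <= (0 : R) < 1 by rewrite lexx ltr01.
move=> [/edgeP[r rI ->] /edgeP[s sI E]]; rewrite E; move: E.
(* Parameter 1 is rewritten as parameter 0 of the next edge, so that injectivity on [0, 1) applies
   in each of the four cases. *)
case: (le1_cases rI) => [r1|->]; case: (le1_cases sI) => [s1|->].
- by move=> /(edge_pt_inj r1 s1)[/eqP]; rewrite (negPf ij).
- rewrite edge_pt1 => /(edge_pt_inj r1 I0)[-> _].
  by rewrite edge_pt0; split; [left|right].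
- rewrite edge_pt1 => /(edge_pt_inj I0 s1)[<- <-].
  by rewrite edge_pt0; split; [right|left].
- rewrite !edge_pt1 => /(edge_pt_inj I0 I0)[/addIr/eqP].
  by rewrite (negPf ij).
Qed.

Lemma polygonP x : polygon v x ->
  exists k, exists2 r, 0 <= r < 1 & x = edge_pt k r.
Proof.
move=> [k _ /edgeP[r rI ->]]; case: (le1_cases rI) => [rI'|->].
  by exists k, r.
by exists (k + 1), 0; rewrite ?edge_pt1 // lexx ltr01.
Qed.

Lemma edge_pt_polygon k r : 0 <= r <= 1 -> polygon v (edge_pt k r).
Proof. by move=> rI; exists k => //; exists r. Qed.

Lemma ltW_itv r : 0 <= r < 1 -> 0 <= r <= 1.
Proof. by move=> /andP[-> /ltW]. Qed.

Lemma pwmap_polygon : pwmap F @` polygon v = polygon v.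
Proof.
apply/seteqP; split => [_ [x /polygonP[k [r /ltW_itv rI ->]] <-]|x].
  by rewrite pwmap_edge_pt //; exact: edge_pt_polygon.
move=> /polygonP[k [r /ltW_itv rI ->]].
exists (edge_pt (k - m%:R) r); first exact: edge_pt_polygon.
by rewrite pwmap_edge_pt // subrK.
Qed.

Lemma is_cycle_edge_pt r :
  is_cycle F (@rotseq l m n) (fun i => edge_pt (i * m%:R) r).
Proof.
move=> i; rewrite mulrDl mul1r -fhalf_edge_pt.
by rewrite -[_ * m%:R * d]mulrA invmodK mulr1.
Qed.

(** The half-maps chosen by S keep the position r, so these points form one orbit, which visits the
    edges in steps of m. *)
Definition Scycle_of r := [set edge_pt k r | k in [set: 'Z_n]].

Lemma Scycle_of_is_Scycle r : is_Scycle F (@rotseq l m n) (Scycle_of r).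
Proof.
exists (edge_pt 0 r); have cq := is_cycle_edge_pt r.
have := is_cycle_eq cq; rewrite mul0r => E; split=> //.
have oE (k : nat) :
    orbS F (@rotseq l m n) (edge_pt 0 r) k = edge_pt (k%:R * m%:R) r.
  by have := orbS_is_cycle k cq; rewrite mul0r.
apply/seteqP; split => x /= [k kn <-]; last by rewrite oE; exists (k%:R * m%:R).
exists (val (k * d)); first exact: ltn_ord.
by rewrite oE natr_Zp -mulrA [d * _]mulrC invmodK mulr1.
Qed.

Lemma Scycle_of_inj r s : 0 <= r < 1 -> 0 <= s < 1 ->
  Scycle_of r = Scycle_of s -> r = s.
Proof.
move=> rI sI E; have : Scycle_of r (edge_pt 0 r) by exists 0.
by rewrite E => -[k _ /(edge_pt_inj sI rI)[_ ->]].
Qed.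

Lemma polygon_Scycles :
  polygon v = \bigcup_(C in Scycle_of @` `[0, 1[) C.
Proof.
apply/seteqP; split => x.
  move=> /polygonP[k [r rI ->]]; exists (Scycle_of r); first by exists r.
  by exists k.
move=> [_ [r /= rI <-] [k _ <-]]; apply: edge_pt_polygon.
by apply: ltW_itv; move: rI; rewrite in_itv.
Qed.


(** The family is an injective image of [0, 1), which has Lebesgue measure 1, while countable sets
    are null. *)
Lemma Scycle_of_uncountable : ~ countable (Scycle_of @` `[0 : R, 1[).
Proof.
have inj : {in `[0 : R, 1[%classic &, injective Scycle_of}.
  move=> r s /set_mem rI /set_mem sI; apply: Scycle_of_inj.
    by move: rI; rewrite /= in_itv.
  by move: sI; rewrite /= in_itv.
rewrite (eq_countable (inj_card_eq inj)) => /countable_lebesgue_measure0.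
rewrite lebesgue_measure_itv /= lte_fin ltr01 sube0 => /eqP.
by rewrite eqe oner_eq0.
Qed.

Lemma least_period_v : least_period (fun i : nat => v (i%:R * m%:R)) n.
Proof.
split=> // [i|k /andP[k0 kn] /(_ 0)]; first by rewrite natrD pchar_Zp // addr0.
rewrite add0n mul0r => /v_inj E.
have : (k%:R : 'Z_n) = 0.
  have <- : k%:R * m%:R * d = k%:R by rewrite -mulrA invmodK mulr1.
  by rewrite E !mul0r.
move/(congr1 val); rewrite /= val_Zp_nat // modn_small // => k0'.
by rewrite k0' in k0.
Qed.

Lemma range_v : range v = range (fun i : nat => v (i%:R * m%:R)).
Proof.
apply/seteqP; split => _ [k _ <-]; last by exists (k%:R * m%:R).
exists (val (k * d)) => //.
by rewrite natr_Zp -mulrA [d * _]mulrC invmodK mulr1.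
Qed.

Definition arc_pt k r : R * R := circle_pt (((val k)%:R + r) / n%:R).

Lemma arc_pt1 k : arc_pt k 1 = arc_pt (k + 1) 0.
Proof.
rewrite /arc_pt addr0; case: (ltnP (val k) n'.+1) => kn.
  by rewrite Zn_valS // natr1.
rewrite Zn_val_last //; have -> : val k = n'.+1.
  by apply/eqP; rewrite eqn_leq kn -ltnS ltn_ord.
rewrite natr1 divff ?pnatr_eq0 // mul0r -[1]add0r.
exact: (circle_pt_periodic 1 0).
Qed.

Lemma arc_pt_inj i j r s : 0 <= r < 1 -> 0 <= s < 1 ->
  arc_pt i r = arc_pt j s -> i = j /\ r = s.
Proof.
move=> rI sI; have n0 : (0 : R) < n%:R by rewrite ltr0n.
have B k (u : R) : 0 <= u < 1 -> 0 <= ((val k)%:R + u) / n%:R < 1.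
  move=> /andP[u0 u1]; apply/andP; split.
    by rewrite divr_ge0 ?ler0n // addr_ge0 // ler0n.
  rewrite ltr_pdivrMr // mul1r.
  have : ((val k).+1%:R <= n%:R :> R) by rewrite ler_nat; exact: ltn_ord.
  by rewrite -natr1; lra.
move=> /circle_pt_inj E.
have {}E : (val i)%:R + r = (val j)%:R + s.
  have /E : `|((val i)%:R + r) / n%:R - ((val j)%:R + s) / n%:R| < 1.
    move: (B i r rI) (B j s sI); move: (_ / _) (_ / _) => x y xI yI.
    by rewrite ltr_norml; lra.
  by apply: mulIf; rewrite invr_eq0 gt_eqF.
have ij : val i = val j.
  (* The integer part of k + u recovers the index of the arc. *)
  have T k (u : R) : 0 <= u < 1 -> Num.trunc ((val k)%:R + u) = val k.
    by move=> /andP[u0 u1]; apply: truncn_def; rewrite lerDl u0 -natr1 ltrD2l.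
  by rewrite -(T i r rI) E T.
by split; [exact: val_inj|move: E; rewrite ij; exact: addrI].
Qed.

(* The end of an edge is identified with the start of the next one. *)
Lemma wrap_eq (T : Type) (f : 'Z_n -> R -> T) :
  (forall k, f k 1 = f (k + 1) 0) ->
  (forall i j r s, 0 <= r < 1 -> 0 <= s < 1 ->
     f i r = f j s -> i = j /\ r = s) ->
  let w k r := if r == 1 then (k + 1, 0) else (k, r) in
  forall i j r s, 0 <= r <= 1 -> 0 <= s <= 1 -> f i r = f j s <-> w i r = w j s.
Proof.
move=> f1 finj w i j r s rI sI.
have wE k (u : R) : f k u = f (w k u).1 (w k u).2.
  by rewrite /w; case: eqP => [->|].
have wI k (u : R) : 0 <= u <= 1 -> 0 <= (w k u).2 < 1.
  move=> uI; rewrite /w; case: eqP => [|u1] /=; first by rewrite lexx ltr01.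
  by case: (le1_cases uI).
rewrite wE (wE j); split => [/(finj _ _ _ _ (wI _ _ rI) (wI _ _ sI))|-> //].
by case: (w i r) (w j s) => [? ?] [? ?] /= [-> ->].
Qed.

Lemma edge_pt_arc_pt i j r s : r \in `[0, 1] -> s \in `[0, 1] ->
  edge_pt i r = edge_pt j s <-> arc_pt i r = arc_pt j s.
Proof.
rewrite !in_itv /= => rI sI.
have A := wrap_eq edge_pt1 edge_pt_inj i j rI sI.
have B := wrap_eq arc_pt1 arc_pt_inj i j rI sI.
by split=> [/A/B|/B/A].
Qed.

Lemma arc_pt_rotation k r :
  arc_pt (k + m%:R) r = rotation (2 * pi * (m%:R / n%:R)) (arc_pt k r).
Proof.
rewrite /arc_pt -circle_pt_rotation -mulrDl [in RHS]addrAC -natrD.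
have -> : val (k + m%:R) = ((val k + m) %% n)%N.
  by rewrite /= val_Zp_nat // modnDmr.
(* Reduction modulo n drops a multiple of n, that is, whole turns. *)
rewrite [in RHS](divn_eq (val k + m) n) natrD natrM -addrA [in RHS]mulrDl.
by rewrite mulfK ?pnatr_eq0 // [X in _ = circle_pt X]addrC circle_pt_periodic.
Qed.

Lemma unit_circleE :
  @unit_circle R = \bigcup_(k in [set: 'Z_n]) (arc_pt k @` `[0, 1]).
Proof.
have n0 : (0 : R) < n%:R by rewrite ltr0n.
apply/seteqP; split => z; last first.
  by move=> [k _ [r _ <-]]; exact: circle_pt_unit.
move=> /circle_pt_surj[x /andP[x0 x1] ->].
have xn0 : 0 <= x * n%:R by rewrite mulr_ge0.
have := truncn_itv xn0; set k := Num.trunc _ => /andP[kx xk].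
case: (ltnP k n) => kn.
  exists k%:R => //; exists (x * n%:R - k%:R).
    by rewrite /= in_itv /=; move: xk; rewrite -natr1; lra.
  rewrite /arc_pt /= val_Zp_nat // modn_small // addrC subrK.
  by rewrite mulfK // gt_eqF.
(* An index of at least n can only come from a full turn, which is the start of arc 0. *)
have {}x1 : x = 1.
  apply/eqP; rewrite eq_le x1 /= -(ler_pM2r n0) mul1r.
  by apply: le_trans kx; rewrite ler_nat.
exists 0 => //; exists 0; first by rewrite /= in_itv /= lexx ler01.
by rewrite /arc_pt addr0 mul0r x1 -(circle_pt_periodic 1 0) add0r.
Qed.

Lemma edge_pt_continuous k : continuous (edge_pt k).
Proof.
move=> r; apply: cvgD; apply: cvgZr_tmp; last exact: cvg_id.
by apply: cvgB; [exact: cvg_cst|exact: cvg_id].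
Qed.

Lemma arc_pt_continuous k : continuous (arc_pt k).
Proof.
move=> r; apply: continuous_comp; last exact: circle_pt_continuous.
apply: cvgM; last exact: cvg_cst.
by apply: cvgD; [exact: cvg_cst|exact: cvg_id].
Qed.

Lemma polygon_conj_rotation :
  conj_rigid_rotation (pwmap F) (polygon v) (m%:R / n%:R : R).
Proof.
have [h [hh hE]] := @glued_homeo R _ _ 'Z_n 0 edge_pt arc_pt
  (@norm_hausdorff _ _) (@norm_hausdorff _ _)
  edge_pt_continuous arc_pt_continuous edge_pt_arc_pt.
exists h; rewrite unit_circleE; split=> // _ [k _ [r rI <-]].
by rewrite -/(edge_pt k r) pwmap_edge_pt // !hE // arc_pt_rotation.
Qed.

End Polygon.

(** * Sign patterns *)

Section Separation.
Variables (R : realType) (n' : nat).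
Local Notation n := n'.+2.
Implicit Types (t : 'Z_n -> R) (k c : 'Z_n) (r s : R).

Lemma Zn_val_pred k : k != 0 -> val (k - 1) = (val k).-1.
Proof.
move=> k0; case: (ltnP (val (k - 1)) n'.+1) => [/Zn_valS|/Zn_val_last].
  by rewrite subrK => ->.
by rewrite subrK => /eqP; rewrite (negPf k0).
Qed.

Lemma Zn_val1 : val (1 : 'Z_n) = 1%N.
Proof. by rewrite /= modn_small. Qed.

Lemma Zn_valN1 : val (- 1 : 'Z_n) = n'.+1.
Proof. by rewrite /= !modn_small // subSS subn0. Qed.

(** Once c = 0, the equation at k = 0 reads r t_1 = s t_1, so r = s. Exchanging the two points
    replaces c by -c; this reduces c = 0 to the cases r > 0 and r = s = 0. *)
Lemma separatedI t : t 0 = 0 -> t 1 < 0 ->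
  (forall c r s, 0 <= r < 1 -> 0 <= s < 1 -> 0 < r \/ r = 0 /\ s = 0 ->
     (forall k, (1 - r) * t k + r * t (k + 1) =
        (1 - s) * t (k + c) + s * t (k + c + 1)) -> c = 0) ->
  separated t.
Proof.
move=> t0 t1 H c r s rI sI E.
have c0 : c = 0.
  have /andP[r0 _] := rI; have /andP[s0 _] := sI.
  move: r0; rewrite le_eqVlt => /orP[/eqP r0|r0]; last first.
    by apply: (H c r s) => //; left.
  move: s0; rewrite le_eqVlt => /orP[/eqP s0|s0].
    by apply: (H c r s) => //; right.
  apply/eqP; rewrite -oppr_eq0; apply/eqP.
  apply: (H (- c) s r) => // [|k]; first by left.
  by rewrite E subrK.
split=> //; have := E 0; rewrite c0 !addr0 !add0r t0 !mulr0 !add0r.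
by apply: mulIf; rewrite lt_eqF.
Qed.

(** Suppose c is nonzero. At k = -1 the left side is (1 - r) t_{-1} > 0, so edge c - 1 cannot be on
    the left. Then t_c and t_{c+1} are nonnegative, against r t_1 < 0 at k = 0 if r > 0, and against
    t_1 < 0 at k = 1 if r = s = 0. *)
Lemma separated_two_signs t (l : nat) : (l < n)%N ->
  (forall k, (val k <= l)%N -> t k <= 0) ->
  (forall k, (l <= val k)%N -> 0 <= t k) ->
  t 0 = 0 -> t 1 < 0 -> 0 < t (- 1) -> separated t.
Proof.
move=> ln tL tR t0 t1 tN; apply: separatedI => // c r s rI sI rs E.
apply/eqP/negPn/negP => c0.
have cV : val c = (val (c - 1)).+1.
  rewrite Zn_val_pred // prednK // lt0n.
  by apply: contra c0 => /eqP c0; apply/eqP/val_inj.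
have := E 0; have := E (-1).
rewrite !add0r addNr t0 mulr0 addr0 [-1 + c]addrC subrK.
case: (ltnP (val (c - 1)) l) => cl.
  have a : t (c - 1) <= 0 by apply: tL; exact: ltnW.
  have b : t c <= 0 by apply: tL; rewrite cV.
  by move=> e _; move: rI sI => /andP[? ?] /andP[? ?]; nra.
have b : 0 <= t c by apply: tR; rewrite cV ltnW.
case: rs => [r0|[r0 s0]].
  case: (ltnP (val c) n'.+1) => [cn|/Zn_val_last c1].
    have a : 0 <= t (c + 1).
      by apply: tR; rewrite Zn_valS // cV; do 2 apply: leqW.
    by move=> _ e; move: rI sI => /andP[? ?] /andP[? ?]; nra.
  rewrite c1 t0 => _ e.
  by move: rI sI => /andP[? ?] /andP[? ?]; nra.
move=> _ _; have := E 1; rewrite r0 s0 !(subr0, mul1r, mul0r, addr0) => e.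
case: (ltnP (val c) n'.+1) => [cn|/Zn_val_last c1].
  suff a : 0 <= t (1 + c) by move: a; rewrite -e leNgt t1.
  by apply: tR; rewrite [1 + c]addrC Zn_valS // cV; do 2 apply: leqW.
by move: e t1; rewrite [1 + c]addrC c1 t0 => ->; rewrite ltxx.
Qed.

(** The first component vanishes on the whole edge -1, so at k = -1 the equation forces t_{c-1} = 0,
    hence c = 0 or c = 1. If c = 1, then s = 0, and k = 0 gives r t_1 = t_1, against r < 1. *)
Lemma separated_one_sign t : (0 < n')%N -> t 0 = 0 -> t (- 1) = 0 ->
  (forall k, k != 0 -> k != - 1 -> t k < 0) -> separated t.
Proof.
move=> n3 t0 tN1 tneg.
have oneN : (1 : 'Z_n) != - 1.
  apply/eqP => /(congr1 val); rewrite Zn_val1 Zn_valN1 => -[E].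
  by move: n3; rewrite -E.
have t1 : t 1 < 0 by apply: tneg => //; rewrite oner_neq0.
have tle k : t k <= 0.
  case: (eqVneq k 0) => [->|k0]; first by rewrite t0.
  by case: (eqVneq k (-1)) => [->|k1]; [rewrite tN1|exact/ltW/tneg].
have tz k : t k = 0 -> k = 0 \/ k = -1.
  move=> tk; case: (eqVneq k 0) => [|k0]; first by left.
  case: (eqVneq k (-1)) => [|k1]; first by right.
  by have := tneg _ k0 k1; rewrite tk ltxx.
apply: separatedI => // c r s rI sI rs E.
have := E (-1); rewrite addNr t0 tN1 !mulr0 addr0 [-1 + c]addrC subrK => e1.
have a := tle (c - 1); have b := tle c.
have tc1 : t (c - 1) = 0 by move: rI sI => /andP[? ?] /andP[? ?]; nra.
case: (tz _ tc1) => [/eqP|/eqP]; last by rewrite -subr_eq0 opprK subrK => /eqP.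
rewrite subr_eq0 => /eqP c1; move: e1; rewrite c1 subrr t0 mulr0 add0r => e1.
have s0 : s = 0.
  by apply/eqP; move/esym/eqP: e1; rewrite mulf_eq0 (lt_eqF t1) orbF.
have := E 0; rewrite c1 s0 !add0r t0 mulr0 add0r subr0 mul1r mul0r addr0.
by move=> e0; exfalso; have /andP[_ r1] := rI; case: rs => [r0|[r0 _]]; nra.
Qed.

End Separation.

(** * Shrinking points *)

Section ShrinkingCycle.
Variables (R : realType) (N : nat) (F : pwAffine R N) (n' l m : nat).
Local Notation n := n'.+2.
Hypothesis mn : coprime m n.
Hypothesis l0 : (0 < l)%N.
Hypothesis ln : (l < n)%N.
Implicit Types (i j k : 'Z_n) (T : symseq n) (q : 'Z_n -> 'cV[R]_N.+1).

Let d : 'Z_n := invmod m n.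

Lemma mulr_invmodK k : k * m%:R * d = k.
Proof. by rewrite -mulrA invmodK // mulr1. Qed.

Lemma mulr_invmod_inj k j : k * d = j * d -> k = j.
Proof.
move/(congr1 (fun z => z * m%:R)).
by rewrite -!mulrA [d * _]mulrC invmodK // !mulr1.
Qed.

Lemma mulr_invmod_eq0 k : (k * d == 0) = (k == 0).
Proof.
apply/eqP/eqP => [|->]; last by rewrite mul0r.
by rewrite -[X in _ = X -> _](mul0r d) => /mulr_invmod_inj.
Qed.

Lemma val_natl : val (l%:R : 'Z_n) = l.
Proof. by rewrite /= val_Zp_nat // modn_small. Qed.

Lemma val_eq0 k : (val k == 0%N) = (k == 0).
Proof. by []. Qed.

Lemma checkS_ind k :
  @checkS l m n (k * d) = if (0 < val k < l)%N then symL else symR.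
Proof.
rewrite /checkS /flipseq rotseq_ind // mulr_invmod_eq0.
case: eqVneq => [->|k0] /=; first by rewrite l0.
by rewrite lt0n val_eq0 k0.
Qed.

Lemma hatS_ind k :
  @hatS l m n (k * d) = if (val k <= l)%N then symL else symR.
Proof.
rewrite /hatS /flipseq rotseq_ind //.
case: eqVneq => [/mulr_invmod_inj ->|kl]; first by rewrite val_natl ltnn leqnn.
rewrite [in RHS]leq_eqVlt; case: eqVneq => //= E.
by case/negP: kl; rewrite -E natr_Zp.
Qed.

Lemma is_cycle_orbit q T :
  is_cycle F T q ->
  forall k, q ((k + m%:R) * d) = fhalf F (T (k * d)) (q (k * d)).
Proof. by move=> cq k; rewrite mulrDl invmodK. Qed.

Lemma shift_invariant_cycle T q j : unique_cycle F T -> is_cycle F T q ->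
  is_cycle F (shiftseq T j) q -> forall i, q (i + j) = q i.
Proof.
move=> uT cq cjq i; rewrite addrC.
exact: (unique_cycle_shift uT (is_cycle_shift j cq) cjq).
Qed.

Lemma shift_invariant_const q (e : 'Z_n) : e \is a GRing.unit ->
  (forall i, q (i + e) = q i) -> forall i, q i = q 0.
Proof.
move=> Ue H i; have {}H (u : nat) : q (u%:R * e) = q 0.
  elim: u => [|u IH]; first by rewrite mul0r.
  by rewrite -natr1 mulrDl mul1r H.
by rewrite -(H (val (i * e^-1))) natr_Zp mulrVK.
Qed.

Lemma unit_invmod : d \is a GRing.unit.
Proof. by rewrite unitrV unitZpE // coprime_sym. Qed.

(** A constant cycle is a fixed point x on the switching manifold. Multiplying (I - A_L) x = mu b by
    the adjugate and taking first components gives 0 = mu rho^T b. *)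
Lemma no_constant_cycle T q : pmu F != 0 -> rhoTb F != 0 ->
  is_cycle F T q -> fstc (q 0) = 0 -> ~ (forall i, q i = q 0).
Proof.
move=> mu0 rho0 cq q0 qc.
have E : (1%:M - matL F) *m q 0 = pmu F *: pb F.
  rewrite mulmxBl mul1mx -{1}(qc (0 + 1)) cq (fhalf_eq _ (T 0) symL q0).
  by rewrite /fhalf addrK.
have : fstc (\adj (1%:M - matL F) *m ((1%:M - matL F) *m q 0)) = 0.
  by rewrite mulmxA mul_adj_mx mul_scalar_mx /fstc mxE -/(fstc _) q0 mulr0.
rewrite E -scalemxAr /fstc mxE => /eqP; rewrite mulf_eq0 (negPf mu0) /=.
by move: rho0; rewrite /rhoTb /rhoT -row_mul mxE => /negPf ->.
Qed.

(** By uniqueness for the shifted sequence, q would equal its own translate by j; as j generates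
    Z/n, q would be constant. *)
Lemma no_shifted_cycle T q j : pmu F != 0 -> rhoTb F != 0 ->
  fstc (q 0) = 0 -> j \is a GRing.unit ->
  unique_cycle F T -> is_cycle F T q -> ~ is_cycle F (shiftseq T j) q.
Proof.
move=> mu0 rho0 q0 Uj uT cq cjq.
apply: (no_constant_cycle mu0 rho0 cq q0).
exact: (shift_invariant_const Uj (shift_invariant_cycle uT cq cjq)).
Qed.

Lemma is_cycle_relabel_ind T T' q :
  is_cycle F T q ->
  (forall k, fstc (q (k * d)) != 0 -> T' (k * d) = T (k * d)) ->
  is_cycle F T' q.
Proof.
move=> cq H; apply: (is_cycle_relabel cq) => i.
by rewrite -(mulr_invmodK i); exact: H.
Qed.

(** In spatial order [checkS] reads L on 1, ..., l-1; moved back by one place this is S with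
    position l-1 flipped. Hence the second singular matrix P is that of [checkS] started at ld. *)
Lemma shift_checkS_flip : shiftseq (@checkS l m n) (l%:R * d) =
  flipseq (shiftseq (@rotseq l m n) (l.-1%:R * d)) 0.
Proof.
apply/funext => i; rewrite -(mulr_invmodK i); move: (i * _) => k.
rewrite /flipseq /shiftseq mulr_invmod_eq0 -!mulrDl checkS_ind rotseq_ind //.
have -> : l%:R + k = l.-1%:R + k + 1 by rewrite addrAC natr1 prednK.
have valp : val (l.-1%:R : 'Z_n) = l.-1.
  by rewrite /= val_Zp_nat // modn_small // (leq_ltn_trans (leq_pred l) ln).
case: eqVneq => [->|k0].
  rewrite addr0 valp ltn_predL l0 Zn_valS ?valp ?prednK // ?ltnn ?andbF //.
have : val (l.-1%:R + k) != l.-1.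
  apply: contra k0 => /eqP; rewrite -[in RHS]valp => /val_inj/eqP.
  by rewrite -subr_eq0 addrAC subrr add0r.
move: (_ + _) => e el; case: (ltnP (val e) n'.+1) => en.
  rewrite Zn_valS //=; congr (if _ then _ else _).
  by move: el => /=; lia.
rewrite Zn_val_last //= ltnNge (leq_trans _ en) //.
Qed.

(** * Non-terminating shrinking points *)

Section Nonterminating.
Variable q : 'Z_n -> 'cV[R]_N.+1.
Hypothesis cq : is_cycle F (@checkS l m n) q.
Hypothesis ucheck : unique_cycle F (@checkS l m n).
Hypothesis uhat : unique_cycle F (@hatS l m n).
Hypothesis PS0 : PS F (@rotseq l m n) \notin unitmx.
Hypothesis PSl : PS F (shiftseq (@rotseq l m n) (l.-1%:R * d)) \notin unitmx.
Hypothesis adm : forall k, (fstc (q k) < 0 -> @checkS l m n k = symL) /\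
  (0 < fstc (q k) -> @checkS l m n k = symR).

Let t k := fstc (q (k * d)).

Lemma nonterm_t0 : t 0 = 0.
Proof.
rewrite /t mul0r; apply: (PS_singular_fstc0 cq ucheck).
by rewrite /checkS PS_flip0.
Qed.

Lemma nonterm_tl : t l%:R = 0.
Proof.
have := is_cycle_shift (l%:R * d) cq => cql.
have := PS_singular_fstc0 cql (unique_cycle_shift ucheck).
by rewrite addr0; apply; rewrite shift_checkS_flip PS_flip0.
Qed.

Lemma nonterm_sgnL k : (val k <= l)%N -> t k <= 0.
Proof.
rewrite leq_eqVlt => /orP[/eqP kl|kl].
  by rewrite -[k]natr_Zp kl nonterm_tl.
case: (eqVneq k 0) => [->|k0]; first by rewrite nonterm_t0.
rewrite leNgt; apply/negP => /(adm _).2.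
by rewrite checkS_ind kl lt0n val_eq0 k0.
Qed.

Lemma nonterm_sgnR k : (l <= val k)%N -> 0 <= t k.
Proof.
move=> kl; rewrite leNgt; apply/negP => /(adm _).1.
by rewrite checkS_ind [X in _ && X]ltnNge kl andbF.
Qed.

(** The two sequences differ only at the spatial positions 0 and l, where t vanishes. *)
Lemma is_cycle_hatS : is_cycle F (@hatS l m n) q.
Proof.
apply: (is_cycle_relabel_ind cq) => k tk; rewrite hatS_ind checkS_ind.
have k0 : k != 0 by apply: contra tk => /eqP ->; rewrite -/(t 0) nonterm_t0.
rewrite leq_eqVlt lt0n val_eq0 k0 /=; case: eqVneq => //= kl.
by case/negP: tk; rewrite -[k]natr_Zp kl -/(t _) nonterm_tl.
Qed.

Lemma t_neq0 k : fstc (q (k * d)) != 0 -> k != 0 /\ val k != l.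
Proof.
move=> tk; split.
  by apply: contra tk => /eqP ->; rewrite -/(t 0) nonterm_t0.
by apply: contra tk => /eqP kl; rewrite -[k]natr_Zp kl -/(t _) nonterm_tl.
Qed.

Hypothesis l1 : (1 < l < n.-1)%N.
Hypothesis mu0 : pmu F != 0.
Hypothesis rho0 : rhoTb F != 0.

(* A zero at [k0] allows the symbols of [T] to be shifted by [e] along the
   spatial order without losing the cycle. *)
Lemma nonterm_shift (k0 : 'Z_n) T (e : 'Z_n) :
  unique_cycle F T -> is_cycle F T q -> e \is a GRing.unit ->
  (forall k, k != 0 -> val k != l -> k != k0 ->
     T (e * d + k * d) = T (k * d)) ->
  t k0 != 0.
Proof.
move=> uT cT Ue H; apply/eqP => tk0.
apply: (@no_shifted_cycle T q (e * d)) => //.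
- by have := nonterm_t0; rewrite /t mul0r.
- by rewrite unitrM Ue unit_invmod.
apply: (is_cycle_relabel_ind cT) => k tk; have [k1 kl] := t_neq0 tk.
rewrite /shiftseq; apply: H => //; apply: contra tk => /eqP ->.
by rewrite -/(t _) tk0.
Qed.

(** The L-block of [checkS] is 1, ..., l-1 and that of [hatS] is 0, ..., l. A zero at 1 or l-1 frees
    an end of the first block, one at l+1 or -1 a place just outside the second; each makes a shift
    by one step away from that end, or towards that place, harmless. *)
Lemma nonterm_signs : [/\ t 1 < 0, t l.-1%:R < 0, 0 < t l.+1%:R & 0 < t (- 1)].
Proof.
have /andP[l1' ln1] := l1.
have v1 := Zn_val1 n'; have vN := Zn_valN1 n'.
have vp : val (l.-1%:R : 'Z_n) = l.-1.
  by rewrite /= val_Zp_nat // modn_small // (leq_ltn_trans (leq_pred l) ln).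
have vs : val (l.+1%:R : 'Z_n) = l.+1.
  by rewrite /= val_Zp_nat // modn_small.
have U1 : (1 : 'Z_n) \is a GRing.unit by exact: unitr1.
have UN : (-1 : 'Z_n) \is a GRing.unit by rewrite unitrN1.
have neq (a b : 'Z_n) : a != b -> val a != val b.
  by apply: contra => /eqP/val_inj ->.
split; rewrite lt_neqAle.
- rewrite nonterm_sgnL ?v1 ?andbT; last exact: ltnW.
  apply: (nonterm_shift ucheck cq UN) => k k0 kl k1.
  rewrite -mulrDl [-1 + k]addrC !checkS_ind Zn_val_pred //.
  move: (neq _ _ k0) (neq _ _ k1) kl; rewrite v1 /=.
  by move: (nat_of_ord k) => x *; congr (if _ then _ else _); lia.
- rewrite nonterm_sgnL ?vp ?leq_pred ?andbT //.
  apply: (nonterm_shift ucheck cq U1) => k k0 kl k1.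
  rewrite -mulrDl [1 + k]addrC !checkS_ind.
  move: (neq _ _ k0) (neq _ _ k1); rewrite vp => k0' k1'.
  congr (if _ then _ else _); case: (ltnP (val k) n'.+1) => kn.
    by rewrite Zn_valS //; move: k0' k1' => /=; lia.
  by rewrite Zn_val_last //=; move: kn => /=; lia.
- rewrite eq_sym nonterm_sgnR ?vs ?andbT //.
  apply: (nonterm_shift uhat is_cycle_hatS UN) => k k0 kl k1.
  rewrite -mulrDl [-1 + k]addrC !hatS_ind Zn_val_pred //.
  move: (neq _ _ k1); rewrite vs => k1'.
  by congr (if _ then _ else _); move: k1' kl => /=; lia.
- rewrite eq_sym nonterm_sgnR ?vN ?andbT; last exact: ltnW.
  apply: (nonterm_shift uhat is_cycle_hatS U1) => k k0 kl k1.
  rewrite -mulrDl [1 + k]addrC !hatS_ind.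
  move: (neq _ _ k1); rewrite vN => k1'.
  rewrite Zn_valS; last by rewrite ltn_neqAle k1' -ltnS ltn_ord.
  by congr (if _ then _ else _); move: kl => /=; lia.
Qed.

End Nonterminating.
End ShrinkingCycle.

(** * Terminating shrinking points *)

Section Terminating.
Variables (R : realType) (N : nat).

(** [eigenvalue] concerns row eigenvectors; singularity of the transpose gives a column one, and a,
    b are its real and imaginary parts. *)
Lemma is_multiplier_real_pair (A : 'M[R]_N.+1) (z : R[i]) :
  is_multiplier A z ->
  exists a b : 'cV[R]_N.+1, [/\ a != 0 \/ b != 0,
    A *m a = complex.Re z *: a - complex.Im z *: b &
    A *m b = complex.Im z *: a + complex.Re z *: b].
Proof.
move=> zA; pose B := map_mx (real_complex R) A - z%:M.
have /notin_unitmxP[w w0 wB] : B^T \notin unitmx.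
  rewrite unitmx_tr -row_free_unit -kermx_eq0.
  exact: zA.
have {wB} E : map_mx (real_complex R) A *m w^T = z *: w^T.
  apply/eqP; rewrite -subr_eq0 -mul_scalar_mx -mulmxBl; apply/eqP/trmx_inj.
  by rewrite trmx_mul trmxK wB trmx0.
exists (\col_i complex.Re (w ord0 i)), (\col_i complex.Im (w ord0 i)); split.
- case: (eqVneq (\col_i complex.Re (w ord0 i)) 0) => [a0|]; last by left.
  right; apply: contra_neq w0 => b0; apply/rowP => i; rewrite mxE.
  have := congr1 (fun x : 'cV__ => x i ord0) a0.
  have := congr1 (fun x : 'cV__ => x i ord0) b0.
  by rewrite !mxE; case: (w ord0 i) => x y /= -> ->.
- apply/colP => i; rewrite !mxE.
  have := congr1 (fun x : 'cV__ => complex.Re (x i ord0)) E.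
  rewrite !mxE raddf_sum /=; case: (w ord0 i) => x y; case: (z) => p q /= <-.
  apply: eq_bigr => k _; rewrite !mxE; case: (w ord0 k) => x' y' /=.
  by rewrite mul0r subr0.
- apply/colP => i; rewrite !mxE.
  have := congr1 (fun x : 'cV__ => complex.Im (x i ord0)) E.
  rewrite !mxE raddf_sum /=; case: (w ord0 i) => x y; case: (z) => p q /=.
  rewrite addrC => <-.
  apply: eq_bigr => k _; rewrite !mxE; case: (w ord0 k) => x' y' /=.
  by rewrite mul0r addr0.
Qed.

Variables (F : pwAffine R N) (n' m : nat).
Local Notation n := n'.+2.
Hypothesis n3 : (0 < n')%N.
Hypothesis mn : coprime m n.
Implicit Types (i k : 'Z_n) (r : R).
Let d : 'Z_n := invmod m n.

Lemma n_neq0 : (n%:R : R) != 0.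
Proof. by rewrite pnatr_eq0. Qed.

(** Of the angles (2k + 1) pi / n, those for k = 0 and k = -1 are nearest to 0 on the circle. Angles
    beyond half a turn are reflected to where the cosine decreases. *)
Lemma cos_gt_step k : k != 0 -> k != - 1 ->
  cos (2 * pi * (((val k)%:R + 2^-1) / n%:R))
    < cos (2 * pi * (2^-1 / n%:R)) :> R.
Proof.
move=> k0 kN.
have pi0 := pi_gt0 R; have n0 : (0 : R) < n%:R by rewrite ltr0n.
have k1 : (1%:R <= (val k)%:R :> R) by rewrite ler_nat lt0n val_eq0.
have k2 : ((val k)%:R + 2 <= n%:R :> R).
  rewrite -natrD ler_nat addn2 ltnS ltn_neqAle -ltnS ltn_ord andbT.
  by apply: contra kN => /eqP kE; apply/eqP/val_inj; rewrite Zn_valN1.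
set x : R := 2^-1 / n%:R; set y := (_ / _).
have x0 : 0 < x by rewrite divr_gt0.
have xy : x < y by rewrite /x /y ltr_pM2r ?invr_gt0 // ltrDr; lra.
have yx : y < 1 - x.
  rewrite /x /y ltr_pdivrMr // mulrBl mul1r divfK ?gt_eqF //; lra.
have H u : x < u -> u <= 2^-1 -> cos (2 * pi * u) < cos (2 * pi * x).
  move=> xu u1; rewrite ltr_cos ?in_itv /=; [|apply/andP; split; nra..].
  by rewrite ltr_pM2l // mulr_gt0.
case: (lerP y 2^-1) => y2; first exact: H.
have -> : cos (2 * pi * y) = cos (2 * pi * (1 - y)).
  rewrite mulrBr mulr1 mulr_natl addrC cosD2pi cosN //.
by apply: H; lra.
Qed.

Lemma cos_half_step_gt0 : 0 < cos (2 * pi * (2^-1 / n%:R)) :> R.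
Proof.
have pi0 := pi_gt0 R; have n0 : (0 : R) < n%:R by rewrite ltr0n.
have n2 : (3%:R <= n%:R :> R) by rewrite ler_nat.
have -> : 2 * pi * (2^-1 / n%:R) = pi / n%:R :> R.
  by move: (n%:R) n_neq0 => w wz; field.
apply: cos_gt0_pihalf; apply/andP; split.
  by rewrite (lt_trans _ (divr_gt0 pi0 n0)) // oppr_lt0 divr_gt0.
by rewrite ltr_pM2l // ltf_pV2 ?posrE //; lra.
Qed.

Section Rotating.
Variables a b : 'cV[R]_N.+1.
Let c : R := cos (2 * pi * (m%:R / n%:R)).
Let s : R := sin (2 * pi * (m%:R / n%:R)).
Hypothesis Aa : matL F *m a = c *: a - s *: b.
Hypothesis Ab : matL F *m b = s *: a + c *: b.

(** The real part of exp(2 pi i (k + r)/n) (a + i b), with a + i b the complex eigenvector. *)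
Definition rot_pt k r := (arc_pt k r).1 *: a - (arc_pt k r).2 *: b.

Lemma mul_rot_pt k r : matL F *m rot_pt k r = rot_pt (k + m%:R) r.
Proof.
rewrite /rot_pt arc_pt_rotation /rotation -/c -/s.
rewrite mulmxBr -!scalemxAr Aa Ab; move: (arc_pt k r) => [x y] /=.
by apply/colP => i; rewrite !mxE; ring.
Qed.

(* Otherwise every [rot_pt] lies in the switching manifold, and adding one
   to a cycle gives a second cycle with the same symbols. *)
Lemma rot_pt_fstc_neq0 (l : nat) : (0 < l)%N -> (l < n)%N ->
  a != 0 \/ b != 0 ->
  unique_cycle F (@checkS l m n) -> (exists q, is_cycle F (@checkS l m n) q) ->
  fstc a != 0 \/ fstc b != 0.
Proof.
move=> l0 ln ab uT [q cq].
case: (eqVneq (fstc a) 0) => [a0|]; last by left.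
case: (eqVneq (fstc b) 0) => [b0|]; last by right.
have rz k r : rot_pt k r = 0.
  have z0 j : fstc (rot_pt j r) = 0.
    by rewrite /rot_pt /fstc !mxE -!/(fstc _) a0 b0 !mulr0 subrr.
  have cqz : is_cycle F (@checkS l m n) (fun i => q i + rot_pt (i * m%:R) r).
    move=> i; rewrite cq mulrDl mul1r -mul_rot_pt /fhalf.
    by rewrite (matS_col_eq F symL (checkS l m i) (z0 _)) -addrA -mulmxDr.
  have := uT _ _ cq cqz (k * d) => /eqP.
  rewrite -subr_eq0 opprD addrA subrr add0r oppr_eq0.
  by rewrite -mulrA [d * _]mulrC invmodK // mulr1 => /eqP.
have := rz 0 0; rewrite /rot_pt /arc_pt /circle_pt addr0 mul0r mulr0 cos0 sin0.
rewrite scale1r scale0r subr0 => az.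
(* Position n/4 is a quarter turn, where [rot_pt] equals -b. *)
have := rz 0 (n%:R / 4); rewrite /rot_pt az scaler0 sub0r /arc_pt /circle_pt /=.
have -> : 2 * pi * ((0 + n%:R / 4) / n%:R) = pi / 2 :> R.
  by move: (n%:R) n_neq0 => w wz; field.
rewrite sin_pihalf scale1r => /eqP; rewrite oppr_eq0 => /eqP bz.
by case: ab; rewrite ?az ?bz eqxx.
Qed.

Lemma rot_pt_fstc : fstc a != 0 \/ fstc b != 0 ->
  exists r, exists2 g, 0 < g &
    forall k, fstc (rot_pt k r) =
      g * cos (2 * pi * (((val k)%:R + 2^-1) / n%:R)).
Proof.
move=> ab; set a0 := fstc a; set b0 := fstc b.
have S0 : 0 < a0 ^+ 2 + b0 ^+ 2.
  by rewrite lt_neqAle addr_ge0 ?sqr_ge0 // andbT eq_sym paddr_eq0 ?sqr_ge0 //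
    !sqrf_eq0 negb_and; case: ab => ->; rewrite ?orbT.
set g := Num.sqrt (a0 ^+ 2 + b0 ^+ 2).
have g0 : 0 < g by rewrite sqrtr_gt0.
have [|x _ [ax bx]] := @circle_pt_surj R (a0 / g, b0 / g).
  rewrite /unit_circle /= !expr_div_n -mulrDl sqr_sqrtr ?ltW //.
  by rewrite divff // gt_eqF.
(* The phase r puts the crest of the sinusoid midway between the positions -1 and 0, which then have
   equal heights. *)
exists (2^-1 - n%:R * x), g => // k.
have -> : fstc (rot_pt k (2^-1 - n%:R * x)) =
    (arc_pt k (2^-1 - n%:R * x)).1 * a0 - (arc_pt k (2^-1 - n%:R * x)).2 * b0.
  by rewrite /rot_pt /fstc !mxE.
have -> : a0 = g * cos (2 * pi * x) by rewrite -ax mulrC divfK // gt_eqF.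
have -> : b0 = g * sin (2 * pi * x) by rewrite -bx mulrC divfK // gt_eqF.
rewrite /arc_pt /circle_pt /=.
have -> : 2 * pi * (((val k)%:R + 2^-1) / n%:R) =
    2 * pi * (((val k)%:R + (2^-1 - n%:R * x)) / n%:R) + 2 * pi * x :> R.
  by move: (n%:R) n_neq0 => w wz; field.
by rewrite [in RHS]cosD; ring.
Qed.

End Rotating.

Lemma fstc_fixed_point :
  1%:M - matL F \in unitmx ->
  fstc (invmx (1%:M - matL F) *m (pmu F *: pb F)) =
    pmu F * rhoTb F / \det (1%:M - matL F).
Proof.
move=> U; rewrite /invmx U -scalemxAl -scalemxAr /fstc !mxE.
by rewrite /rhoTb /rhoT -row_mul [in RHS]mxE mxE mulrC.
Qed.

Lemma terminating_cycle :
  let theta : R := 2 * pi * m%:R / n%:R in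
  1%:M - matL F \in unitmx ->
  pmu F * rhoTb F / \det (1%:M - matL F) < 0 ->
  is_multiplier (matL F) (expi theta) ->
  unique_cycle F (@checkS n'.+1 m n) ->
  (exists q, is_cycle F (@checkS n'.+1 m n) q) ->
  exists2 q, is_cycle F (@checkS n'.+1 m n) q &
    [/\ fstc (q 0) = 0, fstc (q (- 1 * d)) = 0 &
      forall k, k != 0 -> k != - 1 -> fstc (q (k * d)) < 0].
Proof.
move=> theta U h0 /is_multiplier_real_pair[a [b [ab Aa Ab]]] uT exq.
have thE : theta = 2 * pi * (m%:R / n%:R) by rewrite /theta mulrA.
rewrite /= thE in Aa Ab.
have /(rot_pt_fstc (a := a) (b := b))[r [g g0 rE]] :=
  rot_pt_fstc_neq0 Aa Ab (ltn0Sn n') (ltnSn n'.+1) ab uT exq.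
set x := invmx (1%:M - matL F) *m (pmu F *: pb F).
have xfix : pmu F *: pb F + matL F *m x = x.
  have : (1%:M - matL F) *m x = pmu F *: pb F by rewrite mulKVmx.
  by rewrite mulmxBl mul1mx => <-; rewrite subrK.
set h := fstc x; have {}h0 : h < 0 by rewrite /h fstc_fixed_point.
set C := cos (2 * pi * (2^-1 / n%:R)) : R.
have C0 : 0 < C := cos_half_step_gt0.
(* This scale solves h + kap g C = 0, which puts the vertices 0 and -1 on the switching manifold. *)
pose kap := - h / (g * C).
pose q i := x + kap *: rot_pt a b (i * m%:R) r.
have qE k : fstc (q (k * d)) =
    h * (1 - cos (2 * pi * (((val k)%:R + 2^-1) / n%:R)) / C).
  rewrite /q -mulrA [d * _]mulrC invmodK // mulr1 [LHS]mxE [X in _ + X]mxE.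
  rewrite -!/(fstc _) rE /kap -/h; field.
  by rewrite !gt_eqF.
have q0 : fstc (q (0 * d)) = 0.
  by rewrite qE add0r divff ?subrr ?mulr0 // gt_eqF.
have qN : fstc (q (- 1 * d)) = 0.
  have -> : fstc (q (- 1 * d)) = h * (1 - C / C); last first.
    by rewrite divff ?subrr ?mulr0 // gt_eqF.
  rewrite qE Zn_valN1 /C; congr (_ * (1 - _ / _)).
  have -> : 2 * pi * ((n'.+1%:R + 2^-1) / n%:R) =
      - (2 * pi * (2^-1 / n%:R)) + pi *+ 2 :> R.
    have -> : n'.+1%:R = n%:R - 1 :> R by rewrite -[n%:R]natr1 addrK.
    by rewrite -mulr_natl; move: (n%:R) n_neq0 => w wz; field.
  by rewrite cosD2pi cosN.
have qneg k : k != 0 -> k != - 1 -> fstc (q (k * d)) < 0.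
  move=> k0 kN; rewrite qE nmulr_rlt0 // subr_gt0 ltr_pdivrMr // mul1r.
  exact: cos_gt_step.
exists q; last by split=> //; rewrite -(mul0r d).
(* The polygon is an orbit of f^L alone. For l = n-1, [checkS] differs from the all-L sequence only
   at positions 0 and -1, where the first component is 0. *)
have cL : is_cycle F (fun=> symL) q.
  move=> i; rewrite /q mulrDl mul1r -(mul_rot_pt Aa Ab) /fhalf /=.
  by rewrite [in RHS]mulmxDr -[in RHS]scalemxAr addrA xfix.
apply: (is_cycle_relabel_ind (m := m) mn cL) => k qk; rewrite checkS_ind //.
have k0 : k != 0 by apply: contra qk => /eqP ->; rewrite q0.
have kN : k != -1 by apply: contra qk => /eqP ->; rewrite qN.
rewrite lt0n val_eq0 k0 /= ifT // ltn_neqAle -ltnS ltn_ord andbT.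
by apply: contra kN => /eqP kE; apply/eqP/val_inj; rewrite Zn_valN1.
Qed.

End Terminating.

(** * Assembly of both cases *)

Lemma shrinking_polygon (R : realType) (N : nat) (F : pwAffine R N)
    (n' l m : nat) (q : 'Z_n'.+2 -> 'cV[R]_N.+1) (p : nat -> 'cV[R]_N.+1) :
  let n := n'.+2 in let t k := fstc (q (k * invmod m n)) in
  (0 < n')%N -> coprime m n -> (l < n)%N ->
  is_cycle F (@checkS l m n) q -> (forall i, p i = q i%:R) ->
  t 0 = 0 -> (forall k, (val k <= l)%N -> t k <= 0) ->
  (forall k, (l <= val k)%N -> 0 <= t k) -> separated t ->
  least_period p n /\
  (exists v : 'Z_n -> 'cV[R]_N.+1,
    [/\ simple_ngon v, range v = range p & pwmap F @` polygon v = polygon v] /\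
    ((exists K : set (set 'cV[R]_N.+1),
        [/\ ~ countable K, forall C, K C -> is_Scycle F (@rotseq l m n) C &
            polygon v = \bigcup_(C in K) C]) /\
     conj_rigid_rotation (pwmap F) (polygon v) (m%:R / n%:R : R))).
Proof.
move=> n t n3 mn ln cq pq t0 tL tR tsep; pose v k := q (k * invmod m n).
(* S and [checkS] differ only at index 0, where t vanishes. *)
have cS : is_cycle F (@rotseq l m n) q.
  apply: (is_cycle_relabel cq) => i qi; rewrite /checkS /flipseq ifN //.
  by apply: contra qi => /eqP ->; rewrite -(mul0r (invmod m n)) -/(t 0) t0.
have el k : (val k < l)%N -> fstc (v k) <= 0 /\ fstc (v (k + 1)) <= 0.
  move=> kl; split; apply: tL; first exact: ltnW.
  by case: (ltnP (val k) n'.+1) => [/Zn_valS ->|/Zn_val_last ->].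
have er k : (l <= val k)%N -> 0 <= fstc (v k) /\ 0 <= fstc (v (k + 1)).
  move=> lk; split; first exact: tR.
  case: (ltnP (val k) n'.+1) => [kn|/Zn_val_last ->]; last first.
    by rewrite -/(t 0) t0.
  by apply: tR; rewrite Zn_valS // leqW.
have vs k : v (k + m%:R) = pwmap F (v k).
  rewrite /v (is_cycle_orbit mn cS) rotseq_ind //.
  case: ltnP => [/el|/er] [tk _]; first by rewrite pwmapL.
  by rewrite pwmapR.
have pv : p = fun i : nat => v (i%:R * m%:R).
  by apply/funext => i; rewrite pq /v mulr_invmodK.
rewrite pv; split; first exact: (least_period_v mn ln el er vs tsep).
exists v; split; last split.
- split; first exact: (simple_ngon_v n3 mn ln el er vs tsep).
    exact: range_v.
  exact: (pwmap_polygon mn ln el er vs).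
- exists (Scycle_of v @` `[0, 1[); split; last exact: polygon_Scycles.
    exact: (Scycle_of_uncountable mn ln el er vs tsep).
  by move=> _ [r _ <-]; exact: (Scycle_of_is_Scycle mn ln el er vs).
- exact: (polygon_conj_rotation mn ln el er vs tsep).
Qed.

Lemma shrink_pt_cycle (R : realType) (N : nat) (F : pwAffine R N)
    (n' l m : nat) :
  1%:M - MS F (@checkS l m n'.+2) \in unitmx ->
  is_cycle F (@checkS l m n'.+2)
    (fun i => orbS F (@checkS l m n'.+2) (shrink_pt F l m n'.+2) (val i)).
Proof.
by move=> U; apply: orbS_cycle; rewrite /shrink_pt -scalemxAr mulKVmx.
Qed.

Theorem lemma7 (R : realType) (N : nat) (hN : (2 <= N.+1)%N)
    (F : pwAffine R N) (l m n : nat)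
    (hl : (l < n)%N) (hm : (m < n)%N) (hmn : coprime m n)
    (hF : nonterminating_shrinking_point F l m n \/
          terminating_shrinking_point F l m n) :
  let d : 'Z_n := invmod m n in
  let p : nat -> 'cV[R]_N.+1 := orbS F (@checkS l m n) (shrink_pt F l m n) in
  let t : 'Z_n -> R := fun i => fstc (p (val i)) in
  (t 0 = 0 /\ t (l%:R * d) = 0) /\
  ((nonterminating_shrinking_point F l m n ->
      [/\ t d < 0, t (l.-1%:R * d) < 0, 0 < t (l.+1%:R * d) & 0 < t (- d)]) /\
   (terminating_shrinking_point F l m n ->
      forall i : 'Z_n, i != 0 -> i != -1 -> t (i * d) < 0)) /\
  least_period p n /\
  (exists v : 'Z_n -> 'cV[R]_N.+1,
    [/\ simple_ngon v, range v = range p & pwmap F @` polygon v = polygon v] /\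
    ((exists K : set (set 'cV[R]_N.+1),
        [/\ ~ countable K, forall C, K C -> is_Scycle F (@rotseq l m n) C &
            polygon v = \bigcup_(C in K) C]) /\
     conj_rigid_rotation (pwmap F) (polygon v) (m%:R / n%:R : R))).
Proof.
have n3 : (3 <= n)%N by case: hF => -[]; [move=> [] /andP[]; lia|case].
(* Writing n as n'+2 makes ['Z_n] compute as Z/n. *)
case: n n3 hl hm hmn hF => [//|[//|n']] n3 ln mltn mn hF d p t.
have U : 1%:M - MS F (@checkS l m n'.+2) \in unitmx.
  by case: hF => -[_ []].
have := shrink_pt_cycle U; set q := fun i => _; rewrite -/p in q * => cq.
have uT := unitmx_unique_cycle U.
have pq i : p i = q i%:R by rewrite -(orbS_is_cycle i cq).
have tq i : t i = fstc (q i) by [].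
have tq1 : t d = fstc (q (1 * d)) by rewrite mul1r.
have tqN : t (- d) = fstc (q (- 1 * d)) by rewrite mulN1r.
have nonterm : nonterminating_shrinking_point F l m n'.+2 ->
    [/\ t 0 = 0, t (l%:R * d) = 0 &
     [/\ t d < 0, t (l.-1%:R * d) < 0, 0 < t (l.+1%:R * d) & 0 < t (- d)]] /\
    [/\ forall k : 'Z_n'.+2, (val k <= l)%N -> t (k * d) <= 0,
        forall k : 'Z_n'.+2, (l <= val k)%N -> 0 <= t (k * d) &
        separated (fun k => t (k * d))].
  move=> [[l1 mu0 rho0] [PS0 PSl _ Uhat adm]].
  have /andP[l1' _] := l1; have l0 : (0 < l)%N := ltnW l1'.
  have uhat := unitmx_unique_cycle Uhat.
  have {}adm k : (fstc (q k) < 0 -> @checkS l m n'.+2 k = symL) /\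
      (0 < fstc (q k) -> @checkS l m n'.+2 k = symR).
    by have := adm (val k) (ltn_ord k); rewrite natr_Zp.
  have t0 := nonterm_t0 cq uT PS0; have tl := nonterm_tl mn l0 ln cq uT PSl.
  have sg := nonterm_signs mn l0 ln cq uT uhat PS0 PSl adm l1 mu0 rho0.
  have sL := nonterm_sgnL mn l0 ln cq uT PS0 PSl adm.
  have sR := nonterm_sgnR mn l0 ln adm.
  have t00 : t 0 = 0 by rewrite tq -(mul0r d).
  split; split=> //; first by rewrite tq1 tqN; case: sg.
  by case: sg => a _ _ b; exact: (separated_two_signs ln sL sR t0 a b).
have term : terminating_shrinking_point F l m n'.+2 ->
    [/\ l = n'.+1, t 0 = 0, t (- 1 * d) = 0 &
      forall k, k != 0 -> k != - 1 -> t (k * d) < 0].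
  move=> [[/= lE _] [UL h _ Am _]]; subst l.
  have [q' cq' [a b c]] := terminating_cycle n3 mn UL h Am uT (ex_intro _ q cq).
  have qq' := uT _ _ cq cq'.
  by split=> //; rewrite ?tq ?qq' // => k k0 kN; rewrite tq qq'; exact: c.
have all : [/\ t 0 = 0, t (l%:R * d) = 0 &
    [/\ forall k : 'Z_n'.+2, (val k <= l)%N -> t (k * d) <= 0,
        forall k : 'Z_n'.+2, (l <= val k)%N -> 0 <= t (k * d) &
        separated (fun k => t (k * d))]].
  case: hF => [/nonterm[[-> -> _] H] //|/term[lE t0 tN tneg]].
  (* Since l = n-1, the zero at -d is the required zero at ld. *)
  have lN : (l%:R : 'Z_n'.+2) = -1.
    by apply/eqP; rewrite lE -subr_eq0 opprK natr1 pchar_Zp.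
  have tle k : t (k * d) <= 0.
    case: (eqVneq k 0) => [->|k0]; first by rewrite mul0r t0.
    by case: (eqVneq k (-1)) => [->|kN]; [rewrite tN|exact/ltW/tneg].
  split=> //; first by rewrite lN.
  split=> // [k lk|]; last by apply: separated_one_sign; rewrite ?mul0r.
  have -> : k = -1; last by rewrite tN.
  apply/val_inj/eqP; rewrite Zn_valN1 eqn_leq -ltnS ltn_ord.
  by move: lk; rewrite lE.
have [t0 tl [sL sR tsep]] := all.
split=> //; split; last first.
  by apply: (shrinking_polygon n3 mn ln cq pq) => //; rewrite mul0r.
split=> [/nonterm[[_ _ //]]|/term[_ _ _ tneg] i i0 iN].
exact: tneg.
Qed.
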